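(* Let $u_1,\ldots,u_m$ be distinct vectors in $V$ and $a_1,\ldots,a_m$ nonzero elements of $\mathbb{F}$, and define $h\in R^*$ by $h(p)=\sum_{i=1}^m a_ip(u_i)$ for $p\in R$. For $e\in\mathbb{N}$ let $h_e$ be the restriction of $h$ to the space $R_{\le e}$ of polynomials of degree at most $e$. Then the following are equivalent: (i) there is $e_0$ such that the orbit $O_nh_e$ is Zariski closed in $(R_{\le e})^*$ for all $e\ge e_0$; (ii) the $O_n$-orbit of $(u_1,\ldots,u_m)$ in $V^m$ is Zariski closed; (iii) the restriction of the bilinear form to the span of $u_1,\ldots,u_m$ is nondegenerate.
   Context: $\mathbb{F}$ is an algebraically closed field of characteristic zero and $V$ an $n$-dimensional $\mathbb{F}$-vector space with a nondegenerate symmetric bilinear form; $O_n$ is its orthogonal group. $R=\mathbb{F}[x_1,\ldots,x_n]$ is the ring of polynomial functions on $V$ ($x_i$ coordinates w.r.t. an orthonormal basis), $R^*$ its linear dual. $O_n$ acts on $R$ by $(gp)(v)=p(g^{-1}v)$, preserving $R_{\le e}$, and on $(R_{\le e})^*$ by $(gh)(p)=h(g^{-1}p)$; it acts diagonally on $V^m$. *)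

(* Defs.v *)
From HB Require Import structures.
From mathcomp Require Import all_boot all_order all_algebra.
From mathcomp Require Export sesquilinear.
From mathcomp Require Export mpoly.

Set Implicit Arguments.
Unset Strict Implicit.
Unset Printing Implicit Defensive.

Import GRing.Theory.
Local Open Scope ring_scope.

(* [msize p] is the degree of [p] plus one (and [msize 0 = 0]), so
   [msize p <= e.+1] says that [p] has degree at most [e]. *)
Definition mpoly_deg_le (n : nat) (R : nzRingType) (e : nat) :
  {pred {mpoly R[n]}} := fun p => (msize p <= e.+1)%N.

Section DegLe.
Variables (n : nat) (R : nzRingType) (e : nat).

Fact mpoly_deg_le_submod : submod_closed (@mpoly_deg_le n R e).
Proof.
split=> [|c p q]; rewrite !unfold_in ?msize0 // => lp lq.
apply: leq_trans (msizeD_le _ _) _; rewrite geq_max lq andbT.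
exact: leq_trans (msizeZ_le _ _) lp.
Qed.

HB.instance Definition _ :=
  GRing.isSubmodClosed.Build R {mpoly R[n]} (@mpoly_deg_le n R e)
    mpoly_deg_le_submod.

Record bpoly := BPoly { bpoly_val :> {mpoly R[n]};
                        _ : bpoly_val \in @mpoly_deg_le n R e }.

HB.instance Definition _ := [isSub for bpoly_val].
HB.instance Definition _ := [Choice of bpoly by <:].
HB.instance Definition _ := [SubChoice_isSubLmodule of bpoly by <:].

Fact bpoly_val_is_linear : linear bpoly_val. Proof. by []. Qed.

HB.instance Definition _ :=
  GRing.isLinear.Build R bpoly {mpoly R[n]} _ bpoly_val bpoly_val_is_linear.

Lemma bpolyP (p : bpoly) : bpoly_val p \in @mpoly_deg_le n R e.
Proof. by case: p. Qed.

Fact bpoly_vecaxiom : Vector.axiom #|{: 'X_{1..n < e.+1}}| bpoly.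
Proof.
pose M (i : 'I_#|{: 'X_{1..n < e.+1}}|) : 'X_{1..n} := bmnm (enum_val i).
have Minj : injective M by move=> i j /val_inj /enum_val_inj.
exists (fun p : bpoly => \row_i (val p)@_(M i)).
  by move=> c p q; apply/rowP=> i; rewrite !mxE /= mcoeffD mcoeffZ.
pose g (r : 'rV[R]_#|{: 'X_{1..n < e.+1}}|) : {mpoly R[n]} :=
  \sum_i r 0 i *: 'X_[M i].
have gP r : g r \in @mpoly_deg_le n R e.
  apply: rpred_sum => i _; apply: rpredZ.
  by rewrite unfold_in msizeX ltnS -ltnS bmdeg.
have gE r i : (g r)@_(M i) = r 0 i.
  rewrite raddf_sum /= (bigD1 i) //= mcoeffZ mcoeffX eqxx mulr1 big1 ?addr0 //.
  by move=> j ji; rewrite mcoeffZ mcoeffX (inj_eq Minj) (negPf ji) mulr0.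
exists (fun r => BPoly (gP r)) => [p|r]; last by apply/rowP=> i; rewrite mxE gE.
apply/val_inj/mpolyP=> m /=.
have [me|me] := ltnP (mdeg m) e.+1.
  have -> : m = M (enum_rank (BMultinom me)) by rewrite /M enum_rankK.
  by rewrite gE mxE.
have z (q : bpoly) : (val q)@_m = 0.
  apply: memN_msupp_eq0; apply: msize_mdeg_ge.
  by apply: leq_trans me; apply: bpolyP.
by rewrite (z p) (z (BPoly (gP _))).
Qed.

HB.instance Definition _ := Lmodule_hasFinDim.Build R bpoly bpoly_vecaxiom.

End DegLe.

Section Zariski.
Variables (F : fieldType) (W : vectType F).

(* Polynomial functions on [W] are polynomials in the coordinates with respect
   to the basis [vbasis {:W}]; the notion does not depend on the basis. *)
Definition zariski_closed (Z : W -> Prop) : Prop :=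
  exists S : {mpoly F[\dim {:W}]} -> Prop, forall w : W,
    Z w <-> (forall p, S p -> p.@[fun i => coord (vbasis {:W}) i w] = 0).

End Zariski.

Section Orthogonal.
Variables (F : fieldType) (V : vectType F) (form : {symmetric V}).

Definition nondegenerate_on (U : {vspace V}) : Prop :=
  {in U, forall x, {in U, forall y, form x y = 0} -> x = 0}.

(* When [form] is nondegenerate, an isometry is automatically invertible. *)
Definition in_On (g : 'End(V)) : Prop := isometry form form g.

Definition On_orbit (W : Type) (act : 'End(V) -> W -> W) (x : W) : W -> Prop :=
  fun y => exists2 g, in_On g & y = act g x.

End Orthogonal.

Definition diag_act (F : fieldType) (V : vectType F) (m : nat) (g : 'End(V))
  (u : {ffun 'I_m -> V}) : {ffun 'I_m -> V} := [ffun i => g (u i)].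

(* Polynomial functions on [V] are written in the coordinates with respect to
   the basis [b]. *)
Section PolyAction.
Variables (F : fieldType) (V : vectType F) (n : nat) (b : n.-tuple V).

Definition mpoly_at (p : {mpoly F[n]}) (v : V) : F :=
  p.@[fun i => coord b i v].

(* The linear forms x_i \o g^-1. *)
Definition inv_coords (g : 'End(V)) : n.-tuple {mpoly F[n]} :=
  [tuple \sum_(j < n) coord b i ((g^-1)%VF b`_j) *: 'X_j | i < n].

(* The action (g p)(v) = p (g^-1 v), see [mpoly_actE]. *)
Definition mpoly_act (g : 'End(V)) (p : {mpoly F[n]}) : {mpoly F[n]} :=
  p \mPo inv_coords g.

Lemma mpoly_actE (g : 'End(V)) (p : {mpoly F[n]}) (v : V) :
  basis_of {:V} b -> mpoly_at (mpoly_act g p) v = mpoly_at p ((g^-1)%VF v).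
Proof.
move=> bB; rewrite /mpoly_at comp_mpoly_meval; apply: meval_eq => i.
rewrite tnth_mktuple raddf_sum /=.
rewrite [in RHS](coord_basis bB (memvf v)) !linear_sum /=.
by apply: eq_bigr => j _; rewrite mevalZ mevalXU !linearZ /= mulrC.
Qed.

Lemma mpoly_act_deg_le (g : 'End(V)) (e : nat) (p : bpoly n F e) :
  mpoly_act g p \in @mpoly_deg_le n F e.
Proof.
have X1 (i : 'I_n) : tnth (inv_coords g) i \in @mpoly_deg_le n F 1.
  rewrite tnth_mktuple; apply: rpred_sum => j _.
  by apply: rpredZ; rewrite unfold_in msizeX mdeg1.
have M1 d (q r : {mpoly F[n]}) k : q \in @mpoly_deg_le n F d ->
    r \in @mpoly_deg_le n F k -> q * r \in @mpoly_deg_le n F (d + k)%N.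
  have [->|q0] := eqVneq q 0; first by rewrite mul0r => *; apply: rpred0.
  have [->|r0] := eqVneq r 0; first by rewrite mulr0 => *; apply: rpred0.
  rewrite !unfold_in msizeM // => lq lr.
  by rewrite -subn1 leq_subLR add1n -addSn -addnS leq_add.
rewrite /mpoly_act comp_mpolyEX big_seq; apply: rpred_sum => m mp.
apply: rpredZ; rewrite comp_mpolyX.
have le_me : (mdeg m <= e)%N.
  by rewrite -ltnS (leq_trans (msize_mdeg_lt mp)) //; apply: bpolyP.
suff : \prod_(i < n) tnth (inv_coords g) i ^+ m i
    \in @mpoly_deg_le n F (mdeg m).
  by rewrite !unfold_in => /leq_trans; apply; rewrite ltnS.
rewrite mdegE; elim/big_rec2: _ => [|i d q _ IH]; first by rewrite unfold_in msize1.
apply: (M1) => //; elim: (m i) => [|k IHk]; first by rewrite expr0 unfold_in msize1.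
by rewrite exprS -add1n; apply: M1 => //; apply: X1.
Qed.

Section Bounded.
Variable e : nat.

Definition bpoly_act (g : 'End(V)) (p : bpoly n F e) : bpoly n F e :=
  BPoly (mpoly_act_deg_le g p).

Fact bpoly_act_is_linear g : linear (bpoly_act g).
Proof. by move=> c p q; apply/val_inj; rewrite /= /mpoly_act linearP. Qed.

HB.instance Definition _ g :=
  GRing.isLinear.Build F (bpoly n F e) (bpoly n F e) _ (bpoly_act g)
    (bpoly_act_is_linear g).

Definition bpoly_dual := 'Hom(bpoly n F e, F^o).

(* (g h)(p) = h (g^-1 p), see [dual_actE]. *)
Definition dual_act (g : 'End(V)) (h : bpoly_dual) : bpoly_dual :=
  (h \o linfun (bpoly_act (g^-1)%VF))%VF.

Lemma dual_actE g (h : bpoly_dual) p :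
  dual_act g h p = h (bpoly_act (g^-1)%VF p).
Proof. by rewrite comp_lfunE lfunE. Qed.

Definition dual_restr (h : {linear {mpoly F[n]} -> F^o}) : bpoly_dual :=
  linfun (h \o @bpoly_val n F e).

Lemma dual_restrE (h : {linear {mpoly F[n]} -> F^o}) (p : bpoly n F e) :
  dual_restr h p = h p.
Proof. by rewrite lfunE. Qed.

End Bounded.

Section PointFunctional.
Variables (m : nat) (a : 'I_m -> F) (u : {ffun 'I_m -> V}).

Definition point_functional (p : {mpoly F[n]}) : F^o :=
  \sum_(i < m) a i * mpoly_at p (u i).

Fact point_functional_is_linear : linear point_functional.
Proof.
move=> c p q; rewrite /point_functional scaler_sumr -big_split /=.
apply: eq_bigr => i _; rewrite /mpoly_at mevalD mevalZ mulrDr.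
by rewrite mulrCA.
Qed.

HB.instance Definition _ :=
  GRing.isLinear.Build F {mpoly F[n]} F^o _ point_functional
    point_functional_is_linear.

End PointFunctional.

End PolyAction.

(* Main.v *)
(* If x is a nonzero vector of U = <u_1, ..., u_m> orthogonal to U, complete it to
   a hyperbolic pair (x, y); the isometries x |-> t x, y |-> t^-1 y restrict on U
   to polynomial maps in t which at t = 0 kill x. The limits of the two orbits at
   t = 0 then lie in the closures but not in the orbits: for functionals, because
   evaluations at 2m points are separated in degree 2m. Hence (i) => (iii) and
   (ii) => (iii). If U is nondegenerate, Witt's theorem shows that the orbit of u
   is cut out by the Gram matrix and the linear relations, which is (iii) => (ii).

   For (iii) => (i), let phi(w) = sum_i a_i ev_{w_i}, so that phi(u) = h. Some
   polynomial D in the Gram entries vanishes at (u_{t 1}, ..., u_{t m}) for every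
   self-map t of {1, ..., m} not preserving the Gram matrix of u, but not at u.
   Since such a Gram matrix has pairwise distinct rows, the remaining t are
   permutations, and evaluating the m-th tensor power of phi(w) at D q, for q
   symmetric, gives a nonzero constant multiple of q(w) for all w in the orbit of
   u. So each symmetric q is a polynomial in phi(w), and the coordinates of w, as
   roots of prod_i (T - x_k(w_i)), are integral over the functions of phi(w). By
   lying over, any h' in the closure of the orbit of h_e is phi(w') restricted to
   degree e, for some w' in the closed orbit of u. *)
Require Import Defs.
From HB Require Import structures.
From mathcomp Require Import all_boot all_order all_algebra.
From mathcomp Require Import ring.
From Stdlib Require Import Classical.

Set Implicit Arguments.
Unset Strict Implicit.
Unset Printing Implicit Defensive.

Import GRing.Theory.
Local Open Scope ring_scope.

(** * Lying over *)

Lemma eigenvector_horner_mx (F : fieldType) (n : nat) (A : 'M[F]_n.+1)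
    (v : 'rV_n.+1) (c : F) (p : {poly F}) :
  v *m A = c *: v -> v *m horner_mx A p = p.[c] *: v.
Proof.
move=> vA; elim/poly_ind: p => [|p d IH]; first by
  rewrite rmorph0 mulmx0 horner0 scale0r.
rewrite rmorphD rmorphM /= horner_mx_X horner_mx_C mulmxDr mulmxA IH.
by rewrite -scalemxAl vA mul_mx_scalar hornerMXaddC scalerA scalerDl.
Qed.

Section LyingOver.

Variables (F : closedFieldType) (X : Type).

Section Step.

Variables (P : comNzRingType) (iota : {rmorphism F -> P}).
Variables (ev : X -> {rmorphism P -> F}) (chi : {rmorphism P -> F}).
Hypothesis chi_iota : cancel iota chi.
Hypothesis ev_chi : forall f, (forall x, ev x f = 0) -> chi f = 0.
Variable z : X -> F.

(** The kernel of the map from [{poly P}] to functions on [X] sending the variable to [z]. Extending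
    [chi] to the image of this map amounts to finding a common root of the reductions of the
    kernel. *)
Definition vanishes_along (f : {poly P}) : Prop :=
  forall x, root (map_poly (ev x) f) (z x).

(* The norm [det (f C)], for [C] the companion matrix of [p], is killed by every
   [ev x] because [z x] is an eigenvalue of [C]; its image under [chi] is a
   power of [c]. *)
Lemma vanishes_along_not_const (p f : {poly P}) (c : F) :
  p \is monic -> vanishes_along p -> vanishes_along f ->
  map_poly chi f = c%:P -> c = 0.
Proof.
move=> p_monic pz fz fc.
have [[x0]|noX] := classic (inhabited X); last first.
  have: chi 1 = 0 by apply: ev_chi => x; case: noX.
  by move/eqP; rewrite rmorph1 oner_eq0.
(* Positive degree gives the companion matrix a nonzero size, as [horner_mx] requires: a monic
   constant is 1 and has no root at [z x0]. *)
have : (size p).-1 != 0%N.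
  apply/negP=> p1; have /size1_polyC pE : (size p <= 1)%N.
    by case: (size p) p1 => [|[]].
  have := pz x0; move: p_monic; rewrite pE monicE lead_coefC => /eqP ->.
  by rewrite rmorph1 rootC oner_eq0.
have := companionmxK p_monic; move: (companionmx p).
case: (size p).-1 => // n C CE _.
have : chi (\det (horner_mx C f)) = 0.
  apply: ev_chi => x; rewrite -det_map_mx map_horner_mx; apply/eqP/det0P.
  have := pz x; rewrite -CE map_char_poly -eigenvalue_root_char.
  case/eigenvalueP=> v vC v0; exists v => //.
  by rewrite (eigenvector_horner_mx _ vC) (eqP (fz x)) scale0r.
rewrite -det_map_mx map_horner_mx fc horner_mx_C det_scalar.
by move/eqP; rewrite expf_eq0 => /andP[_ /eqP].
Qed.

(** The reductions form an ideal of [{poly F}]. Euclidean division, by induction on the size of a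
    nonzero reduction, reaches one that divides all the others; it is not constant by the previous
    lemma, so it has a root. *)
Lemma vanishes_along_common_root (p : {poly P}) :
  p \is monic -> vanishes_along p ->
  exists c, forall f, vanishes_along f -> root (map_poly chi f) c.
Proof.
move=> p_monic pz.
suff IH k : forall f, vanishes_along f -> map_poly chi f != 0 ->
    (size (map_poly chi f) <= k)%N ->
    exists c, forall f, vanishes_along f -> root (map_poly chi f) c.
  by apply: (IH _ p) => //; apply/monic_neq0/monic_map.
elim: k => [|k IH] f fz f0 fk; first by move: f0; rewrite -size_poly_leq0 fk.
have [fdvd|] := classic (forall g, vanishes_along g ->
    map_poly chi f %| map_poly chi g).
  have [|/negbNE f1] := boolP (size (map_poly chi f) != 1%N).
    case/closed_rootP=> c fc; exists c => g /fdvd fg.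
    exact: root_dvdp fg fc.
  have [c c0 fE] := size_poly1P _ f1.
  by case/eqP: c0; apply: vanishes_along_not_const p_monic pz fz fE.
move/not_all_ex_not=> [g gP]; have [gz /negP ndvd] := imply_to_and _ _ gP.
(* The quotient is lifted through [iota], so that the remainder is again the reduction of a
   polynomial vanishing along [z]. *)
pose q := map_poly iota (map_poly chi g %/ map_poly chi f).
have qE : map_poly chi q = map_poly chi g %/ map_poly chi f.
  by rewrite /q -map_poly_comp (eq_map_poly (g := id)) ?map_poly_id // => c;
     apply: chi_iota.
have rE : map_poly chi (g - q * f) = map_poly chi g %% map_poly chi f.
  by rewrite rmorphB rmorphM /= qE
    {1}(divp_eq (map_poly chi g) (map_poly chi f)) addrC addKr.
apply: (IH (g - q * f)).
- move=> x; rewrite rmorphB rmorphM /root !hornerE (eqP (gz x)) (eqP (fz x)).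
  by rewrite mulr0 subr0.
- by rewrite rE.
- by rewrite rE -ltnS (leq_trans _ fk) // ltn_modp.
Qed.

End Step.

(* Lying over, for the ring of functions on [X] generated by the image of [P]
   and finitely many functions [z k] integral over it; the ring is presented
   abstractly as [P'] with its evaluations [ev']. *)
Lemma integral_extension (P : comNzRingType) (iota : {rmorphism F -> P})
    (ev : X -> {rmorphism P -> F}) (chi : {rmorphism P -> F}) :
  cancel iota chi ->
  (forall f, (forall x, ev x f = 0) -> chi f = 0) ->
  forall (z : nat -> X -> F) (s : nat),
  (forall k, (k < s)%N -> exists2 p : {poly P}, p \is monic &
     forall x, root (map_poly (ev x) p) (z k x)) ->
  exists (P' : comNzRingType) (j : {rmorphism P -> P'})
     (ev' : X -> {rmorphism P' -> F}) (chi' : {rmorphism P' -> F})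
     (Z : nat -> P'),
  [/\ forall x f, ev' x (j f) = ev x f, forall f, chi' (j f) = chi f,
      forall f, (forall x, ev' x f = 0) -> chi' f = 0
    & forall k x, (k < s)%N -> ev' x (Z k) = z k x].
Proof.
move=> chi_iota ev_chi z; elim=> [_|s IH int].
  by exists P, idfun, ev, chi, (fun=> 0).
have [|P' [j [ev' [chi' [Z [ev'E chi'E ev_chi' ZE]]]]]] := IH.
  by move=> k ks; apply: int; apply: ltnW.
have [p p_monic pz] := int s (ltnSn s).
have chi'_iota : cancel (j \o iota) chi' by move=> c /=; rewrite chi'E.
have [||c cP] := vanishes_along_common_root chi'_iota ev_chi' (z := z s)
    (p := map_poly j p).
- exact: monic_map.
- move=> x; rewrite -map_poly_comp (eq_map_poly (g := ev x)) //.
  by move=> f /=; rewrite ev'E.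
(* No quotient by the kernel is formed: it suffices that the new [chi'] kills whatever vanishes on
   [X], which is the choice of [c]. *)
exists {poly P'}, (polyC \o j).
exists (fun x => horner_eval (z s x) \o map_poly (ev' x)).
exists (horner_eval c \o map_poly chi').
exists (fun k => if k == s then 'X else (Z k)%:P); split=> [x f|f|f fz|k x].
- by rewrite /= /horner_eval map_polyC hornerC /= ev'E.
- by rewrite /= /horner_eval map_polyC hornerC /= chi'E.
- by apply/eqP/cP=> x; apply/eqP/fz.
rewrite ltnS leq_eqVlt /= /horner_eval; have [-> _|ks /= lt_ks] := eqVneq k s.
  by rewrite map_polyX hornerX.
by rewrite map_polyC hornerC /= ZE.
Qed.

End LyingOver.

(** * Symmetric bilinear forms *)

Lemma closed_field_sqrt (F : closedFieldType) (c : F) : exists t : F, t ^+ 2 = c.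
Proof.
have /closed_rootP [t] : size ('X^2 - c%:P : {poly F}) != 1%N by rewrite size_XnsubC.
by rewrite rootE !hornerE subr_eq0 => /eqP tc; exists t.
Qed.

Lemma memv_span_codom (F : fieldType) (V : vectType F) (m : nat)
    (u : 'I_m -> V) (v : V) :
  v \in <<codom u>>%VS -> exists c : 'I_m -> F, v = \sum_i c i *: u i.
Proof.
rewrite codomE span_def big_map big_enum /= => /memv_sumP [w wu ->].
have /fin_all_exists [c cE] : forall i, exists c : F, w i = c *: u i.
  by move=> i; have /vlineP[c ->] := wu i isT; exists c.
by exists c; apply: eq_bigr.
Qed.

Section SymmetricForm.

Variables (F : closedFieldType) (V : vectType F) (form : {symmetric V}).

Lemma sformC x y : form x y = form y x.
Proof. by rewrite hermC expr0 mul1r. Qed.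

Lemma sformZl c x y : form (c *: x) y = c * form x y.
Proof. exact: linearZl_LR. Qed.

Lemma sformZr c x y : form x (c *: y) = c * form x y.
Proof. by rewrite sformC sformZl sformC. Qed.

Lemma sform0l y : form 0 y = 0.
Proof. exact: linear0l. Qed.

Lemma sformDl x y z : form (x + y) z = form x z + form y z.
Proof. exact: linearDl. Qed.

Lemma sformDr x y z : form z (x + y) = form z x + form z y.
Proof. exact: linearDr. Qed.

Lemma sformBl x y z : form (x - y) z = form x z - form y z.
Proof. exact: linearBl. Qed.

Lemma sformBr x y z : form z (x - y) = form z x - form z y.
Proof. exact: linearBr. Qed.

Lemma sform_suml I (r : seq I) (P : pred I) (E : I -> V) y :
  form (\sum_(i <- r | P i) E i) y = \sum_(i <- r | P i) form (E i) y.
Proof. exact: linear_sumlz. Qed.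

Lemma sform_sumr I (r : seq I) (P : pred I) (E : I -> V) x :
  form x (\sum_(i <- r | P i) E i) = \sum_(i <- r | P i) form x (E i).
Proof. exact: linear_sumr. Qed.

Lemma isometry_eq0 (g : 'End(V)) x :
  nondegenerate form -> in_On form g -> g x = 0 -> x = 0.
Proof.
move=> /eqP nd gO gx; apply/eqP; rewrite -memv0 -nd; apply/mem_orthovP => y _.
by rewrite -gO gx sform0l.
Qed.

Lemma isometry_lker0 (g : 'End(V)) :
  nondegenerate form -> in_On form g -> lker g == 0%VS.
Proof.
move=> nd gO; rewrite -subv0; apply/subvP=> v; rewrite memv_ker memv0 => /eqP gv.
by rewrite (isometry_eq0 nd gO gv).
Qed.

Definition orthonormal_seq (s : seq V) : Prop :=
  forall i j, (i < size s)%N -> (j < size s)%N ->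
    form s`_i s`_j = (i == j)%:R.

Lemma orthonormal_seqP s : orthonormal form s -> orthonormal_seq s.
Proof.
move=> /andP[/allP norm1 orth].
have {orth} : pairwise (fun v w => form v w == 0) s.
  by elim: s orth {norm1} => //= v s IH /andP[]; rewrite andbT => -> /IH ->.
move=> /(pairwiseP 0) orth i j lti ltj; have [<-|ij] := eqVneq i j.
  exact/eqP/norm1/mem_nth.
wlog lt_ij : i j lti ltj ij / (i < j)%N.
  move=> H; have [/H|/H|/eqP] := ltngtP i j; [by apply| |by rewrite (negPf ij)].
  by rewrite sformC; apply; rewrite // eq_sym.
exact/eqP/orth.
Qed.

Definition orthoproj (s : seq V) (v : V) : V :=
  \sum_(i < size s) form v s`_i *: s`_i.

Lemma form_orthonormal_sum s (c : 'I_(size s) -> F) (j : 'I_(size s)) :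
  orthonormal_seq s -> form (\sum_i c i *: s`_i) s`_j = c j.
Proof.
move=> os; rewrite sform_suml (bigD1 j) //= sformZl os // eqxx mulr1.
rewrite big1 ?addr0 // => i ij; rewrite sformZl os //.
by rewrite (inj_eq val_inj) (negPf ij) mulr0.
Qed.

Lemma orthonormal_seq_free s : orthonormal_seq s -> free s.
Proof.
move=> os; apply/(@freeP _ _ _ (in_tuple s)) => c c0 i.
by rewrite -(form_orthonormal_sum c i os) c0 sform0l.
Qed.

Lemma orthoproj_id s v : orthonormal_seq s -> v \in <<s>>%VS -> orthoproj s v = v.
Proof.
move=> os vs; have := coord_span (X := in_tuple s) vs => vE.
rewrite {2}vE; apply: eq_bigr => i _; congr (_ *: _).
by rewrite {1}vE form_orthonormal_sum.
Qed.

Lemma orthoproj_mem s v : orthoproj s v \in <<s>>%VS.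
Proof.
by apply: memv_suml => i _; apply/memvZ/memv_span/mem_nth.
Qed.

Lemma form_sub_orthoproj s v i : orthonormal_seq s -> (i < size s)%N ->
  form (v - orthoproj s v) s`_i = 0.
Proof.
move=> os lti; rewrite sformBl.
have := form_orthonormal_sum (fun i => form v s`_i) (Ordinal lti) os.
by rewrite /orthoproj /= => ->; rewrite subrr.
Qed.

Lemma orthonormal_parseval s x y : orthonormal_seq s -> x \in <<s>>%VS ->
  form x y = \sum_(i < size s) form x s`_i * form y s`_i.
Proof.
move=> os xs; rewrite -{1}(orthoproj_id os xs) sform_suml.
by apply: eq_bigr => i _; rewrite sformZl (sformC y).
Qed.

Hypothesis char0 : [pchar F] =i pred0.

(** Gram-Schmidt, where the component [x] orthogonal to [s] may be isotropic. Nondegeneracy then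
    gives [y'] orthogonal to [s] and not to [x]. If [y'] is isotropic too, [x + y'] has norm twice
    [form x y'], which is nonzero. *)
Lemma orthonormal_seq_extend (U : {vspace V}) (s : seq V) :
  nondegenerate_on form U -> orthonormal_seq s -> {subset s <= U} ->
  ~~ (U <= <<s>>)%VS ->
  exists2 x, x \in U & orthonormal_seq (rcons s x).
Proof.
move=> ndU os sU /subvPn [v vU vs].
have sUv : (<<s>> <= U)%VS by apply/span_subvP.
have projU z : z \in U -> z - orthoproj s z \in U.
  by move=> zU; rewrite rpredB // (subvP sUv) // orthoproj_mem.
suff [x xU [xs xx]] : exists2 x, x \in U &
    (forall i, (i < size s)%N -> form x s`_i = 0) /\ form x x != 0.
  have [t tE] := closed_field_sqrt (form x x)^-1.
  exists (t *: x); first by rewrite rpredZ.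
  move=> i j; rewrite size_rcons !nth_rcons !ltnS.
  rewrite leq_eqVlt => /orP [/eqP ->|lti]; rewrite leq_eqVlt => /orP [/eqP ->|ltj].
  - by rewrite ltnn eqxx sformZl sformZr mulrA -expr2 tE mulVf.
  - by rewrite ltnn ltj !eqxx sformZl xs // mulr0 gtn_eqF.
  - by rewrite ltnn lti !eqxx sformZr sformC xs // mulr0 ltn_eqF.
  - by rewrite lti ltj os.
pose x := v - orthoproj s v.
have xU : x \in U by apply: projU.
have x0 : x != 0.
  by apply: contraNneq vs => /subr0_eq ->; apply: orthoproj_mem.
have xs i : (i < size s)%N -> form x s`_i = 0 by apply: form_sub_orthoproj.
have [xx|] := eqVneq (form x x) 0; last by exists x.
have [y yU xy] : exists2 y, y \in U & form x y != 0.
  apply: NNPP => noy; case/eqP: x0; apply: ndU => // y yU.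
  by apply/eqP/negbNE/negP=> xy; apply: noy; exists y.
pose y' := y - orthoproj s y.
have y'U : y' \in U by apply: projU.
have y's i : (i < size s)%N -> form y' s`_i = 0 by apply: form_sub_orthoproj.
have xy' : form x y' != 0.
  rewrite sformBr /orthoproj sform_sumr big1 ?subr0 // => i _.
  by rewrite sformZr xs // mulr0.
have [yy|] := eqVneq (form y' y') 0; last by exists y'.
clearbody x y'; exists (x + y'); first by rewrite rpredD.
split=> [i lti|]; first by rewrite sformDl xs // y's // addr0.
rewrite sformDl !sformDr /= xx yy add0r addr0 (sformC y') -mulr2n.
by rewrite -mulr_natr mulf_eq0 negb_or xy' (iffLR (pcharf0P F) char0).
Qed.

Lemma orthonormal_seq_complete (U : {vspace V}) (s : seq V) :
  nondegenerate_on form U -> orthonormal_seq s -> {subset s <= U} ->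
  exists t, orthonormal_seq (s ++ t) /\ <<s ++ t>>%VS = U.
Proof.
move=> ndU; have [k] := ubnP (\dim U - size s); elim: k s => // k IH s lt_k os sU.
have [Us|nUs] := boolP (U <= <<s>>)%VS.
  exists [::]; rewrite cats0; split=> //.
  by apply/eqP; rewrite eqEsubv Us andbT; apply/span_subvP.
have [x xU osx] := orthonormal_seq_extend ndU os sU nUs.
have sxU : {subset rcons s x <= U}.
  by move=> y; rewrite mem_rcons inE => /orP[/eqP ->|/sU].
have lt_s : (size s < \dim U)%N.
  rewrite -(size_rcons s x) -(eqnP (orthonormal_seq_free osx)).
  by apply: dimvS; apply/span_subvP.
have [|t] := IH (rcons s x) _ osx sxU; last first.
  by rewrite cat_rcons => tP; exists (x :: t).
by rewrite size_rcons subnS prednK ?subn_gt0.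
Qed.

Lemma nondegenerate_onT : nondegenerate form -> nondegenerate_on form fullv.
Proof.
move=> /eqP nd x _ x0; apply/eqP; rewrite -memv0 -nd.
by apply/mem_orthovP => y; apply: x0.
Qed.

(* Witt's extension theorem for a nondegenerate span. *)
Lemma isometry_extension (m : nat) (u w : {ffun 'I_m -> V}) :
  nondegenerate form -> nondegenerate_on form <<codom u>>%VS ->
  (forall i j, form (w i) (w j) = form (u i) (u j)) ->
  (forall c : 'I_m -> F, \sum_i c i *: u i = 0 -> \sum_i c i *: w i = 0) ->
  On_orbit form (@diag_act F V m) u w.
Proof.
move=> nd ndU gram rel; have ndV := nondegenerate_onT nd.
have [e []] : exists t, orthonormal_seq ([::] ++ t) /\ <<[::] ++ t>>%VS = <<codom u>>%VS.
  exact: orthonormal_seq_complete.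
rewrite /= => oe eU.
have /fin_all_exists [c cE] : forall l : 'I_(size e),
    exists c : 'I_m -> F, e`_l = \sum_i c i *: u i.
  by move=> l; apply: memv_span_codom; rewrite -eU memv_span ?mem_nth.
(* The images of the orthonormal basis [e] under the prospective map from [u i] to [w i]; equality
   of the Gram matrices makes them orthonormal. *)
pose e'_ l := \sum_i c l i *: w i.
pose e' := [seq e'_ l | l : 'I_(size e)].
have se' : size e' = size e by rewrite size_map size_enum_ord.
have e'E (l : 'I_(size e)) : e'`_l = e'_ l.
  by rewrite (nth_map l) ?size_enum_ord // nth_ord_enum.
have oe' : orthonormal_seq e'.
  move=> i j; rewrite se' => lti ltj; rewrite -(oe i j) //.
  rewrite -[i]/(val (Ordinal lti)) -[j]/(val (Ordinal ltj)) !e'E !cE.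
  rewrite !sform_suml; apply: eq_bigr => k _; rewrite !sform_sumr.
  by apply: eq_bigr => l _; rewrite !sformZl !sformZr gram.
have [t [ot tV]] := orthonormal_seq_complete ndV oe (fun x _ => memvf x).
have [t' [ot' t'V]] := orthonormal_seq_complete ndV oe' (fun x _ => memvf x).
set E := e ++ t in ot tV; set E' := e' ++ t' in ot' t'V.
have sE' : size E' = size E.
  by rewrite -(eqnP (orthonormal_seq_free ot)) tV -t'V (eqnP (orthonormal_seq_free ot')).
(* The linear map carrying the orthonormal basis [E] to the orthonormal basis [E']. *)
pose gfun v := \sum_(l < size E) form v E`_l *: E'`_l.
have glin : linear gfun.
  move=> d x y; rewrite scaler_sumr -big_split /=; apply: eq_bigr => l _.
  by rewrite sformDl sformZl scalerDl scalerA.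
pose gL := GRing.isLinear.Build F V V _ gfun glin.
pose g : 'End(V) := linfun (HB.pack gfun gL : {linear V -> V}).
have gE v : g v = gfun v by rewrite lfunE.
exists g.
  move=> x y; rewrite !gE.
  rewrite (orthonormal_parseval (s := E) y ot) ?tV ?memvf //.
  rewrite sform_suml; apply: eq_bigr => i _; rewrite sformZl; congr (_ * _).
  rewrite sform_sumr (bigD1 i) //= sformZr ot' ?sE' // eqxx mulr1.
  rewrite big1 ?addr0 // => j ji; rewrite sformZr ot' ?sE' //.
  by rewrite eq_sym (inj_eq val_inj) (negPf ji) mulr0.
apply/ffunP => i; rewrite ffunE gE.
have uU : u i \in <<e>>%VS by rewrite eU memv_span ?codom_f.
have -> : w i = \sum_(l < size e) form (u i) e`_l *: e'`_l.
  (* These coefficients express [u i] minus its expansion in [e], which is zero, through the vectors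
     [u j]; the same relation must hold among the [w j]. *)
  have := rel (fun j => (i == j)%:R - \sum_(l < size e) form (u i) e`_l * c l j).
  have expand (v : 'I_m -> V) :
      \sum_j ((i == j)%:R - \sum_(l < size e) form (u i) e`_l * c l j) *: v j
      = v i - \sum_(l < size e) form (u i) e`_l *: \sum_j c l j *: v j.
    under eq_bigr do rewrite scalerBl; rewrite sumrB; congr (_ - _).
      rewrite (bigD1 i) //= eqxx scale1r big1 ?addr0 // => j ji.
      by rewrite eq_sym (negPf ji) scale0r.
    under eq_bigr do rewrite scaler_suml; rewrite exchange_big /=.
    apply: eq_bigr => l _; rewrite scaler_sumr; apply: eq_bigr => j _.
    by rewrite scalerA.
  rewrite !expand => rel'; apply/subr0_eq; rewrite -[RHS]rel'.
    by congr (_ - _); apply: eq_bigr => l _; rewrite e'E.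
  apply/eqP; rewrite subr_eq0 -{1}(orthoproj_id oe uU); apply/eqP.
  by apply: eq_bigr => l _; rewrite -cE.
have sEe : (size e <= size E)%N by rewrite size_cat leq_addr.
rewrite /gfun (big_ord_widen _ (fun l => form (u i) e`_l *: e'`_l) sEe).
rewrite [RHS](bigID (fun l : 'I__ => (l < size e)%N)) /= [X in _ + X]big1 ?addr0.
  by apply: eq_bigr => l le; rewrite !nth_cat se' le.
move=> l nle; rewrite -(orthoproj_id oe uU) sform_suml big1 ?scale0r // => k _.
rewrite sformZl; have -> : e`_k = E`_k by rewrite nth_cat ltn_ord.
rewrite ot //; last by rewrite (leq_trans _ sEe).
case: eqP => [kl|]; last by rewrite mulr0.
by move: nle; rewrite -kl ltn_ord.
Qed.

End SymmetricForm.

(** * Zariski closures and degenerations *)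

Section PolynomialFunctions.

Variable F : closedFieldType.

Definition polynomial_fun (f : F -> F) : Prop :=
  exists q : {poly F}, forall t, q.[t] = f t.

Lemma polynomial_fun_affine (c d : F) : polynomial_fun (fun t => c + t * d).
Proof. by exists (c%:P + 'X * d%:P) => t; rewrite !hornerE. Qed.

Lemma polynomial_fun_sum (I : finType) (f : I -> F -> F) (c : I -> F) :
  (forall i, polynomial_fun (f i)) ->
  polynomial_fun (fun t => \sum_i f i t * c i).
Proof.
move=> /fin_all_exists [q qE]; exists (\sum_i q i * (c i)%:P) => t.
by rewrite horner_sum; apply: eq_bigr => i _; rewrite hornerM hornerC qE.
Qed.

Lemma polynomial_fun_meval (N : nat) (p : {mpoly F[N]}) (f : 'I_N -> F -> F) :
  (forall i, polynomial_fun (f i)) -> polynomial_fun (fun t => p.@[f^~ t]).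
Proof.
move=> /fin_all_exists [q qE].
exists (\sum_(m <- msupp p) (p@_m)%:P * \prod_i q i ^+ m i) => t.
rewrite mevalE horner_sum; apply: eq_bigr => m _.
rewrite hornerM hornerC horner_prod; congr (_ * _).
by apply: eq_bigr => i _; rewrite horner_exp qE.
Qed.

Lemma polynomial_fun_eq0 (f : F -> F) :
  polynomial_fun f -> (forall t, t != 0 -> f t = 0) -> f 0 = 0.
Proof.
(* The factor ['X] excludes 0, so a nonroot of the product is a nonzero [t] at which [q] does not
   vanish. *)
move=> [q qE] f0; have [q0|/closed_nonrootP[t]] := eqVneq (q * 'X) 0.
  move/eqP: q0; rewrite mulf_eq0 polyX_eq0 orbF => /eqP q0.
  by rewrite -qE q0 horner0.
rewrite rootE hornerM hornerX qE; have [->|/f0 ->] := eqVneq t 0.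
  by rewrite mulr0 eqxx.
by rewrite mul0r eqxx.
Qed.

End PolynomialFunctions.

(** An equation of [Z] pulled back along a polynomial curve is a polynomial in [t] that vanishes at
    all nonzero [t], hence also at 0. *)
Lemma zariski_closed_limit (F : closedFieldType) (W : vectType F)
    (Z : W -> Prop) (gamma : F -> W) :
  zariski_closed Z ->
  (forall i, polynomial_fun (fun t => coord (vbasis {:W}) i (gamma t))) ->
  (forall t, t != 0 -> Z (gamma t)) -> Z (gamma 0).
Proof.
move=> [S SE] poly_gamma Zgamma; apply/SE => p Sp.
apply: (polynomial_fun_eq0 (polynomial_fun_meval p poly_gamma)) => t t0.
exact: (iffLR (SE _) (Zgamma t t0)).
Qed.

Lemma zariski_closedI (F : fieldType) (W : vectType F) (Z : W -> Prop) :
  (forall w0 : W,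
     (forall p : {mpoly F[\dim {:W}]},
        (forall w, Z w -> p.@[fun i => coord (vbasis {:W}) i w] = 0) ->
        p.@[fun i => coord (vbasis {:W}) i w0] = 0) -> Z w0) ->
  zariski_closed Z.
Proof.
move=> ZE; exists (fun p => forall w, Z w ->
  p.@[fun i => coord (vbasis {:W}) i w] = 0) => w.
by split=> [Zw p|]; [apply | apply: ZE].
Qed.

(** * Separation of points by polynomials of bounded degree *)

Section Separation.

Variables (F : fieldType) (V : vectType F) (n : nat) (b : n.-tuple V).
Hypothesis bB : basis_of {:V} b.

Lemma mpoly_separates (v w : V) : v != w ->
  exists l : {mpoly F[n]},
    [/\ (msize l <= 2)%N, mpoly_at b l v != 0 & mpoly_at b l w = 0].
Proof.
move=> vw; have [k kvw] : exists k, coord b k v != coord b k w.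
  apply/existsP; apply: contraNT vw => /existsPn eq_vw; apply/eqP.
  rewrite (coord_basis bB (memvf v)) (coord_basis bB (memvf w)).
  by apply: eq_bigr => k _; rewrite (eqP (negbNE (eq_vw k))).
exists ('X_k - (coord b k w)%:MP); rewrite /mpoly_at; split.
- rewrite (leq_trans (msizeD_le _ _)) // msizeN msizeX msizeC mdeg1 geq_max /=.
  by case: (_ != _).
- by rewrite mevalB mevalXU mevalC subr_eq0.
- by rewrite mevalB mevalXU mevalC subrr.
Qed.

(** A product of affine forms, one for each point of [s], whence the degree bound. *)
Lemma mpoly_separates_seq (v : V) (s : seq V) : v \notin s ->
  exists l : {mpoly F[n]},
    [/\ (msize l <= (size s).+1)%N, mpoly_at b l v != 0
      & {in s, forall w, mpoly_at b l w = 0}].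
Proof.
elim: s => [_|w s IH].
  exists 1; rewrite /mpoly_at meval1; split=> //; last exact: oner_neq0.
  by rewrite msize1.
rewrite inE negb_or => /andP[vw /IH [l [l_deg lv ls]]].
have [k [k_deg kv kw]] := mpoly_separates vw.
have nz (q : {mpoly F[n]}) : mpoly_at b q v != 0 -> q != 0.
  by apply: contraNneq => ->; rewrite /mpoly_at meval0.
exists (k * l); rewrite /mpoly_at; split.
- rewrite msizeM ?nz //= -subn1 leq_subLR add1n.
  by apply: leq_trans (leq_add k_deg l_deg) _; rewrite !addSn.
- by rewrite mevalM mulf_neq0.
move=> x; rewrite inE mevalM => /orP[/eqP ->|/ls xl].
  by rewrite [X in X * _]kw mul0r.
by rewrite [X in _ * X]xl mulr0.
Qed.

End Separation.

(** * Degeneration along a vector in the radical of the span *)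

Section Degeneration.

Variables (F : closedFieldType) (V : vectType F) (form : {symmetric V}).
Hypothesis char0 : [pchar F] =i pred0.
Hypothesis nd : nondegenerate form.
Variable m : nat.
Variable u : {ffun 'I_m -> V}.
Variable x : V.
Hypothesis xU : x \in <<codom u>>%VS.
Hypothesis x_ortho : forall i, form x (u i) = 0.

(* The isometries are [x |-> t x], [y |-> t^-1 y], for a hyperbolic pair [x, y]. *)
Lemma isotropic_degeneration : x != 0 ->
  exists (f : 'End(V)) (c : 'I_m -> F), f x = 0 /\
    forall t, t != 0 ->
      exists2 g, in_On form g & forall i, g (u i) = f (u i) + (t * c i) *: x.
Proof.
move=> x0; have xx : form x x = 0.
  have [c {2}->] := memv_span_codom xU.
  by rewrite sform_sumr big1 // => i _; rewrite sformZr x_ortho mulr0.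
have [y0 xy0] : exists y, form x y != 0.
  apply: NNPP => noy; case/eqP: x0; apply: (nondegenerate_onT nd) => [|y _].
    exact: memvf.
  by apply/eqP/negbNE/negP => xy; apply: noy; exists y.
have two0 : (2%:R : F) != 0 by rewrite (iffLR (pcharf0P F) char0).
have [y [xy yy]] : exists y, form x y = 1 /\ form y y = 0.
  pose y1 := (form x y0)^-1 *: y0.
  have xy1 : form x y1 = 1 by rewrite sformZr mulVf.
  (* Since [x] is isotropic and pairs to 1 with [y1], this correction cancels the norm of [y1] and
     keeps the pairing. *)
  exists (y1 - (form y1 y1 / 2%:R) *: x); clearbody y1.
  rewrite !sformBl !sformBr !sformZl !sformZr xx xy1 (sformC form y1 x) xy1.
  rewrite !mulr0 mulr1 !subr0; split=> //.
  by field.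
have yx : form y x = 1 by rewrite sformC.
pose ffun v := v - form v y *: x.
have flin : linear ffun.
  move=> d v w; rewrite /ffun sformDl sformZl scalerDl -scalerA scalerBr.
  by rewrite opprD addrACA.
pose fL := GRing.isLinear.Build F V V _ ffun flin.
pose f : 'End(V) := linfun (HB.pack ffun fL : {linear V -> V}).
have fE v : f v = v - form v y *: x by rewrite lfunE.
exists f, (fun i => form (u i) y); split; first by rewrite fE xy scale1r subrr.
move=> t t0.
(* This scales [x] by [t] and [y] by [t^-1] and fixes their orthogonal complement. On [u i] the term
   in [t^-1] disappears because [x] is orthogonal to [u i]. *)
pose gfun v := v + ((t - 1) * form v y) *: x + ((t^-1 - 1) * form v x) *: y.
have glin : linear gfun.
  move=> d v w; rewrite /gfun !sformDl !sformZl !mulrDr 2!(mulrCA _ d).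
  by rewrite !scalerDl -!(scalerA d) !scalerDr [RHS]addrACA [in RHS](addrACA (d *: v)).
pose gL := GRing.isLinear.Build F V V _ gfun glin.
pose g : 'End(V) := linfun (HB.pack gfun gL : {linear V -> V}).
have gE v : g v = v + ((t - 1) * form v y) *: x + ((t^-1 - 1) * form v x) *: y.
  by rewrite lfunE.
exists g.
  move=> v w; rewrite !gE !sformDl !sformDr !sformZl !sformZr xx yy xy yx.
  rewrite (sformC form x w) (sformC form y w) (sformC form v w).
  set vx := form v x; set vy := form v y; set wx := form w x; set wy := form w y.
  by field.
move=> i; rewrite gE fE (sformC form (u i) x) x_ortho mulr0 scale0r addr0.
by rewrite mulrBl mul1r scalerBl addrA addrAC.
Qed.

(** The injective [g] preserves the dimension of the span, whereas [f] lowers it if it kills a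
    nonzero [x] there. The index [j] is left free because equality of functionals only compares sets
    of points. *)
Lemma degeneration_not_isometric (f g : 'End(V)) :
  in_On form g -> f x = 0 -> (forall i, exists j, g (u i) = f (u j)) -> x = 0.
Proof.
move=> gO fx gf; pose U := <<codom u>>%VS; have xU' : x \in U := xU.
have kerg := isometry_lker0 nd gO.
have : (\dim (g @: U) <= \dim (f @: U))%N.
  apply: dimvS; rewrite !limg_span; apply/span_subvP => _ /mapP[_ /codomP[i ->] ->].
  by have [j ->] := gf i; apply/memv_span/map_f/codom_f.
have dimg : \dim (g @: U) = \dim U.
  by rewrite -(limg_ker_dim g U) (eqP kerg) capv0 dimv0.
rewrite dimg -{1}(limg_ker_dim f U) -[leqRHS]add0n leq_add2r leqn0 dimv_eq0.
move/eqP=> Uf; apply/eqP; rewrite -memv0 -Uf memv_cap xU' memv_ker.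
by apply/eqP.
Qed.

End Degeneration.

(** * Orbits *)

Section LinearForms.

Variables (F : fieldType) (W : vectType F).

Definition linear_mpoly (f : W -> F) : {mpoly F[\dim {:W}]} :=
  \sum_(i < \dim {:W}) f (vbasis {:W})`_i *: 'X_i.

Lemma linear_mpolyE (f : {linear W -> F^o}) (w : W) :
  (linear_mpoly f).@[fun i => coord (vbasis {:W}) i w] = f w.
Proof.
rewrite [in RHS](coord_vbasis (memvf w)) linear_sum /linear_mpoly raddf_sum /=.
by apply: eq_bigr => i _; rewrite mevalZ mevalXU linearZ mulrC.
Qed.

End LinearForms.

(** Expansion in the dual basis: a curve of functionals is polynomial once its values on a basis
    are. *)
Lemma coord_Hom_eval (F : fieldType) (U : vectType F) (N : nat)
    (X : N.-tuple 'Hom(U, F^o)) (k : 'I_N) (f : 'Hom(U, F^o)) :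
  coord X k f = \sum_(i < \dim {:U}) f (vbasis {:U})`_i *
    coord X k (linfun (coord (vbasis {:U}) i : U -> F^o)).
Proof.
have {1}-> : f = \sum_(i < \dim {:U}) f (vbasis {:U})`_i *:
    linfun (coord (vbasis {:U}) i : U -> F^o).
  apply/lfunP=> v; rewrite sum_lfunE {1}(coord_vbasis (memvf v)) linear_sum.
  by apply: eq_bigr => i _; rewrite scale_lfunE lfunE linearZ; apply: mulrC.
by rewrite linear_sum; apply: eq_bigr => i _; rewrite linearZ.
Qed.

Section Orbits.

Variables (F : closedFieldType) (V : vectType F) (form : {symmetric V}).
Hypothesis char0 : [pchar F] =i pred0.
Hypothesis nd : nondegenerate form.
Variables (n : nat) (b : n.-tuple V).
Hypothesis bB : basis_of {:V} b.
Variables (m : nat) (u : {ffun 'I_m -> V}) (a : 'I_m -> F).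

(** The action on the dual inverts [g], and the action on polynomials inverts it once more. *)
Lemma isometry_lfun_invK (g : 'End(V)) : in_On form g -> ((g^-1)^-1)%VF =1 g.
Proof.
move=> /(isometry_lker0 nd) kerg v.
have kerV : lker (g^-1)%VF == 0%VS by apply/lker0P/(can_inj (lker0_lfunVK kerg)).
by rewrite -{1}(lker0_lfunK kerg v) (lker0_lfunK kerV).
Qed.

Lemma dual_act_point_functional e (g : 'End(V)) : in_On form g ->
  dual_act b g (dual_restr e (point_functional b a u)) =
  dual_restr e (point_functional b a (diag_act g u)).
Proof.
move=> gO; apply/lfunP => p; rewrite dual_actE !dual_restrE /=.
apply: eq_bigr => i _; rewrite /= mpoly_actE // (isometry_lfun_invK gO).
by rewrite ffunE.
Qed.

Definition limit_points (f : 'End(V)) (c : 'I_m -> F) (x : V) (t : F) :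
  {ffun 'I_m -> V} := [ffun i => f (u i) + (t * c i) *: x].

Lemma closed_nondegenerate :
  zariski_closed (On_orbit form (@diag_act F V m) u) ->
  nondegenerate_on form <<codom u>>%VS.
Proof.
move=> closed x xU x_ortho; have [//|x0] := eqVneq x 0.
have x_ortho' i : form x (u i) = 0 by apply/x_ortho/memv_span/codom_f.
have [f [c [fx fc]]] := isotropic_degeneration char0 nd xU x_ortho' x0.
have [|t t0|g gO] := zariski_closed_limit (gamma := limit_points f c x) closed.
- move=> k; have [q qE] := polynomial_fun_affine
    (coord (vbasis fullv) k [ffun i => f (u i)])
    (coord (vbasis fullv) k [ffun i => c i *: x]).
  exists q => t; rewrite qE -[X in _ + X]linearZ -linearD; congr (coord _ _ _).
  by apply/ffunP=> i; rewrite !ffunE scalerA.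
- have [g gO gE] := fc t t0; exists g => //.
  by apply/ffunP=> i; rewrite !ffunE gE.
move=> /ffunP gE; apply: (degeneration_not_isometric nd xU gO fx) => i.
by exists i; have := gE i; rewrite !ffunE mul0r scale0r addr0.
Qed.

Hypothesis u_inj : injective u.
Hypothesis a_neq0 : forall i, a i != 0.

Lemma dual_closed_nondegenerate (e0 : nat) :
  (forall e, (e0 <= e)%N ->
     zariski_closed (On_orbit form (@dual_act F V n b e)
       (dual_restr e (point_functional b a u)))) ->
  nondegenerate_on form <<codom u>>%VS.
Proof.
(* Degree [m + m] suffices to vanish at up to [m + m] given points and not at another one. *)
pose e := maxn e0 (m + m); move=> /(_ e (leq_maxl _ _)) closed x xU x_ortho.
have [//|x0] := eqVneq x 0.
have x_ortho' i : form x (u i) = 0 by apply/x_ortho/memv_span/codom_f.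
have [f [c [fx fc]]] := isotropic_degeneration char0 nd xU x_ortho' x0.
pose gamma t := dual_restr e (point_functional b a (limit_points f c x t)).
have [|t t0|g gO] := zariski_closed_limit (gamma := gamma) closed.
- move=> k.
  pose beta := vbasis (fullv : {vspace bpoly n F e}).
  have [|q qE] := @polynomial_fun_sum F 'I_(\dim (fullv : {vspace bpoly n F e}))
    (fun i t => \sum_j mpoly_at b (beta`_i) (limit_points f c x t j) * a j)
    (fun i => coord (vbasis fullv) k (linfun (coord beta i : bpoly n F e -> F^o))).
    move=> i; apply: polynomial_fun_sum => j.
    apply: polynomial_fun_meval => l.
    have [q qE] := polynomial_fun_affine (coord b l (f (u j))) (coord b l (c j *: x)).
    by exists q => t; rewrite qE ffunE -scalerA [RHS]linearD [X in _ = _ + X]linearZ.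
  exists q => t; rewrite qE [RHS]coord_Hom_eval; apply: eq_bigr => i _.
  rewrite dual_restrE /=; congr (_ * _).
  by apply: eq_bigr => j _; rewrite mulrC.
- have [g gO gE] := fc t t0; exists g => //.
  rewrite dual_act_point_functional //; congr (dual_restr _ (point_functional _ _ _)).
  by apply/ffunP=> i; rewrite !ffunE gE.
rewrite dual_act_point_functional // => eq_gf.
have gK := lker0_lfunK (isometry_lker0 nd gO).
apply: (degeneration_not_isometric nd xU gO fx) => i.
apply: NNPP => nf.
(* If [g (u i)] were no limit point, a polynomial nonzero there and zero on [s] would take the value
   0 under the limit functional, but a nonzero multiple of [a i] under the other. Coincidences among
   the limit points do no harm. *)
pose s := [seq g (u k) | k <- enum 'I_m & k != i] ++ codom (f \o u).
have [|p [p_deg pv ps]] := mpoly_separates_seq bB (v := g (u i)) (s := s).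
  rewrite mem_cat negb_or; apply/andP; split; apply/negP.
    move=> /mapP [k]; rewrite mem_filter => /andP[ki _] /(can_inj gK) /u_inj ik.
    by rewrite ik eqxx in ki.
  by move=> /codomP [k gf]; apply: nf; exists k.
have pe : p \in @mpoly_deg_le n F e.
  rewrite unfold_in (leq_trans p_deg) // ltnS size_cat size_map size_codom leq_max.
  apply/orP; right; apply: leq_add; last by rewrite card_ord.
  by rewrite size_filter -[leqRHS](size_enum_ord m) count_size.
have := congr1 (fun h : bpoly_dual F n e => h (BPoly pe)) eq_gf.
rewrite /gamma !dual_restrE /= /point_functional [LHS]big1 => [|j _].
  rewrite (bigD1 i) //= ffunE big1 ?addr0 => [/esym/eqP|j ji].
    by rewrite mulf_eq0 (negPf (a_neq0 i)) (negPf pv).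
  rewrite ffunE ps ?mulr0 // mem_cat; apply/orP; left.
  by apply: map_f; rewrite mem_filter ji mem_enum.
rewrite ffunE mul0r scale0r addr0 ps ?mulr0 // mem_cat; apply/orP; right.
exact: (codom_f (f \o u)).
Qed.

Hypothesis b_orthonormal : orthonormal form b.

Lemma form_coord v w : form v w = \sum_k coord b k v * coord b k w.
Proof.
have ob := orthonormal_seqP b_orthonormal.
have coordE k v' : coord b k v' = form v' b`_k.
  rewrite [in RHS](coord_basis bB (memvf v')) sform_suml (bigD1 k) //= sformZl.
  rewrite ob ?size_tuple // eqxx mulr1 big1 ?addr0 // => i ik.
  by rewrite sformZl ob ?size_tuple // (inj_eq val_inj) (negPf ik) mulr0.
rewrite {1}(coord_basis bB (memvf v)) sform_suml; apply: eq_bigr => k _.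
by rewrite sformZl sformC (coordE k w).
Qed.

Lemma nondegenerate_closed :
  nondegenerate_on form <<codom u>>%VS ->
  zariski_closed (On_orbit form (@diag_act F V m) u).
Proof.
move=> ndU; apply: zariski_closedI => w vanish.
pose lam i k (w : {ffun 'I_m -> V}) : F^o := coord b k (w i).
have lam_lin i k : linear (lam i k) by move=> c v v'; rewrite /lam !ffunE linearP.
have lamE i k w' : (linear_mpoly (lam i k)).@[fun i => coord (vbasis fullv) i w'] =
    coord b k (w' i).
  pose lamL := GRing.isLinear.Build F {ffun 'I_m -> V} F^o _ (lam i k) (lam_lin i k).
  exact: (linear_mpolyE (HB.pack (lam i k) lamL : {linear {ffun 'I_m -> V} -> F^o})).
apply: (isometry_extension char0 nd ndU) => [i j|c c0].
  pose p := \sum_k linear_mpoly (lam i k) * linear_mpoly (lam j k) -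
    (form (u i) (u j))%:MP.
  have eval w' : p.@[fun i => coord (vbasis fullv) i w'] =
      form (w' i) (w' j) - form (u i) (u j).
    rewrite mevalB mevalC (form_coord (w' i)) raddf_sum; congr (_ - _).
    by apply: eq_bigr => k _ /=; rewrite mevalM !lamE.
  have := vanish p; rewrite eval => vanish'; apply/subr0_eq/vanish' => w' [g gO ->].
  by rewrite eval !ffunE gO subrr.
(* A linear relation among the [u i] gives one linear equation on configurations for each coordinate
   [k]. *)
have eval k w' :
    (\sum_i c i *: linear_mpoly (lam i k)).@[fun i => coord (vbasis fullv) i w'] =
    coord b k (\sum_i c i *: w' i).
  rewrite raddf_sum linear_sum; apply: eq_bigr => i _ /=.
  by rewrite mevalZ lamE linearZ.
rewrite (coord_basis bB (memvf (\sum_i _))) big1 // => k _.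
rewrite -eval vanish ?scale0r // => w' [g _ ->]; rewrite eval.
under eq_bigr do rewrite ffunE -linearZ; rewrite -linear_sum c0 /=.
by rewrite !linear0.
Qed.

End Orbits.

(** * Polynomial functions on configurations *)

Lemma rmorph_mmap (n : nat) (F P : comNzRingType) (f : {rmorphism F -> P})
    (Z : 'I_n -> P) (ev : {rmorphism P -> F}) (q : {mpoly F[n]}) :
  cancel f ev -> ev (mmap f Z q) = q.@[fun i => ev (Z i)].
Proof.
move=> fK; rewrite mevalE rmorph_sum; apply: eq_bigr => M _.
rewrite rmorphM fK rmorph_prod; congr (_ * _).
by apply: eq_bigr => i _; rewrite rmorphXn.
Qed.

Lemma big_enum_rank_pair (R : Type) (idx : R) (op : Monoid.com_law idx)
    (I J : finType) (f : 'I_#|{: I * J}| -> R) :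
  \big[op/idx]_l f l = \big[op/idx]_i \big[op/idx]_j f (enum_rank (i, j)).
Proof.
rewrite pair_bigA (reindex enum_rank) /=; last exact/onW_bij/enum_rank_bij.
by apply: eq_bigr => -[i j].
Qed.

Section Configurations.

Variables (F : closedFieldType) (V : vectType F) (n : nat) (b : n.-tuple V).
Hypothesis bB : basis_of {:V} b.
Variable m : nat.

Local Notation N := #|{: 'I_m * 'I_n}|.

Definition config_coord (w : 'I_m -> V) (l : 'I_N) : F :=
  coord b (enum_val l).2 (w (enum_val l).1).

Definition config_var (i : 'I_m) (k : 'I_n) : {mpoly F[N]} := 'X_(enum_rank (i, k)).

Lemma config_varE i k w : (config_var i k).@[config_coord w] = coord b k (w i).
Proof. by rewrite mevalXU /config_coord enum_rankK. Qed.

(** The exponents of the variables of the [i]-th vector: a monomial on configurations is a product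
    of such parts, hence a pure tensor. *)
Definition config_row (M : 'X_{1..N}) (i : 'I_m) : 'X_{1..n} :=
  [multinom M (enum_rank (i, k)) | k < n].

Lemma mdeg_config_row M i : (mdeg (config_row M i) <= mdeg M)%N.
Proof.
rewrite !mdegE big_enum_rank_pair (bigD1 i) //=.
by under eq_bigr do rewrite mnmE; rewrite leq_addr.
Qed.

Lemma meval_config_monomial (M : 'X_{1..N}) (w : 'I_m -> V) :
  \prod_l config_coord w l ^+ M l =
  \prod_i mpoly_at b 'X_[config_row M i] (w i).
Proof.
rewrite big_enum_rank_pair; apply: eq_bigr => i _; rewrite /mpoly_at mevalX; apply: eq_bigr => k _.
by rewrite mnmE /config_coord enum_rankK.
Qed.

Section Lift.

Variable e : nat.

Local Notation dual_vars h :=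
  (fun i => coord (vbasis {: bpoly_dual F n e}) i h).

Definition eval_mpoly (p : bpoly n F e) : {mpoly F[\dim {: bpoly_dual F n e}]} :=
  linear_mpoly (fun h : bpoly_dual F n e => h p).

Lemma eval_mpolyE p (h : bpoly_dual F n e) : (eval_mpoly p).@[dual_vars h] = h p.
Proof.
have elin : linear (fun h : bpoly_dual F n e => h p : F^o).
  by move=> c h1 h2; rewrite add_lfunE scale_lfunE.
pose eL := GRing.isLinear.Build F (bpoly_dual F n e) F^o _ _ elin.
exact: (linear_mpolyE
  (HB.pack (fun h : bpoly_dual F n e => h p : F^o) eL : {linear bpoly_dual F n e -> F^o})).
Qed.

(* The polynomial [h |-> (h (x) ... (x) h) q] on the dual. *)
Definition tensor_power_eval (q : {mpoly F[N]}) : {mpoly F[\dim {: bpoly_dual F n e}]} :=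
  \sum_(M <- msupp q) q@_M *:
    \prod_i eval_mpoly (insubd (0 : bpoly n F e) 'X_[config_row M i]).

(** Distributing the product over tensor factors across the sum over points gives one term per
    self-map [t]. The degree bound ensures that [insubd] never falls back on its default 0. *)
Lemma tensor_power_evalE (a : 'I_m -> F) (w : {ffun 'I_m -> V}) q :
  (msize q <= e.+1)%N ->
  (tensor_power_eval q).@[dual_vars (dual_restr e (point_functional b a w))] =
  \sum_(t : {ffun 'I_m -> 'I_m})
     (\prod_i a (t i)) * q.@[config_coord (w \o t)].
Proof.
move=> q_deg; under [RHS]eq_bigr do rewrite mevalE mulr_sumr.
rewrite exchange_big raddf_sum /= !big_seq; apply: eq_bigr => M Mq.
rewrite mevalZ rmorph_prod /=; under eq_bigr do rewrite eval_mpolyE dual_restrE /=.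
under [RHS]eq_bigr do rewrite mulrCA meval_config_monomial -big_split /=.
rewrite -mulr_sumr; congr (_ * _).
rewrite -(bigA_distr_bigA (fun i j => a j * mpoly_at b 'X_[config_row M i] (w j))).
apply: eq_bigr => i _; apply: eq_bigr => j _; rewrite insubdK //.
change (msize ('X_[config_row M i] : {mpoly F[n]}) <= e.+1)%N.
rewrite msizeX ltnS (leq_trans (mdeg_config_row M i)) //.
by rewrite -ltnS (leq_trans (msize_mdeg_lt Mq)).
Qed.

End Lift.

(** * Self-maps of the index set and the Gram matrix *)

Section Gram.

Variable form : {symmetric V}.
Hypothesis b_orthonormal : orthonormal form b.

Definition gram_mpoly (i j : 'I_m) : {mpoly F[N]} :=
  \sum_k config_var i k * config_var j k.

Lemma gram_mpolyE i j w : (gram_mpoly i j).@[config_coord w] = form (w i) (w j).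
Proof.
rewrite raddf_sum (form_coord bB b_orthonormal); apply: eq_bigr => k _ /=.
by rewrite mevalM !config_varE.
Qed.

Definition gram_fixed (u : 'I_m -> V) (t : 'I_m -> 'I_m) : bool :=
  [forall i, forall j, form (u (t i)) (u (t j)) == form (u i) (u j)].

Lemma gram_fixedP u t :
  reflect (forall i j, form (u (t i)) (u (t j)) = form (u i) (u j)) (gram_fixed u t).
Proof.
apply: (iffP forallP) => [H i j|H i]; last by apply/forallP=> j; rewrite H.
by apply/eqP; have /forallP := H i.
Qed.

(** A product with one factor per self-map [t]: a Gram entry on which [u] and [u \o t] differ, minus
    its value at [u \o t], or 1 if there is none. *)
Lemma gram_separating_mpoly (u : 'I_m -> V) : exists D : {mpoly F[N]},
  [/\ forall w w', (forall i j, form (w i) (w j) = form (w' i) (w' j)) ->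
        D.@[config_coord w] = D.@[config_coord w'],
      forall t : {ffun 'I_m -> 'I_m}, ~~ gram_fixed u t ->
        D.@[config_coord (u \o t)] = 0
    & D.@[config_coord u] != 0].
Proof.
have /fin_all_exists [D DP] : forall t : {ffun 'I_m -> 'I_m}, exists D : {mpoly F[N]},
  [/\ forall w w', (forall i j, form (w i) (w j) = form (w' i) (w' j)) ->
        D.@[config_coord w] = D.@[config_coord w'],
      ~~ gram_fixed u t -> D.@[config_coord (u \o t)] = 0
    & D.@[config_coord u] != 0].
  move=> t; have [tu|] := boolP (gram_fixed u t).
    by exists 1; split=> // *; rewrite !meval1 ?oner_neq0.
  case/forallPn=> i /forallPn [j ij].
  exists (gram_mpoly i j - (form (u (t i)) (u (t j)))%:MP); split=> [w w' ww'|_|].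
  - by rewrite !mevalB !mevalC !gram_mpolyE ww'.
  - by rewrite !mevalB !mevalC !gram_mpolyE subrr.
  - by rewrite !mevalB !mevalC !gram_mpolyE subr_eq0 eq_sym.
exists (\prod_t D t); split=> [w w' ww'|t tu|].
- rewrite !rmorph_prod; apply: eq_bigr => t _ /=.
  by have [H _ _] := DP t; apply: H.
- rewrite rmorph_prod (bigD1 t) //=; have [_ -> //] := DP t.
  by rewrite mul0r.
- by rewrite rmorph_prod; apply/prodf_neq0 => t _; have [] := DP t.
Qed.

(** If [t] identifies [i] and [i'], then [u i - u i'] is orthogonal to every [u j], so it is zero by
    nondegeneracy. *)
Lemma gram_fixed_inj (u : {ffun 'I_m -> V}) t : injective u ->
  nondegenerate_on form <<codom u>>%VS -> gram_fixed u t -> injective t.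
Proof.
move=> u_inj ndU /gram_fixedP tu i i' tii'; apply/u_inj/subr0_eq/ndU => [|y].
  by rewrite rpredB // memv_span // codom_f.
case/memv_span_codom=> c ->; rewrite sform_sumr big1 // => j _.
by rewrite sformZr sformBl -(tu i) -(tu i') tii' subrr mulr0.
Qed.

End Gram.

(** The integral equation of the [k]-th coordinates of all the vectors; its coefficients are
    symmetric in the vectors. *)
Definition coord_poly (k : 'I_n) : {poly {mpoly F[N]}} :=
  \prod_i ('X - (config_var i k)%:P).

Lemma coord_polyE k w : map_poly (meval (config_coord w)) (coord_poly k) =
  \prod_i ('X - (coord b k (w i))%:P).
Proof.
rewrite rmorph_prod; apply: eq_bigr => i _ /=.
by rewrite rmorphB /= map_polyX map_polyC /= config_varE.
Qed.

Lemma coef_coord_polyE k j w : ((coord_poly k)`_j).@[config_coord w] =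
  (\prod_i ('X - (coord b k (w i))%:P))`_j.
Proof. by rewrite -coord_polyE coef_map. Qed.

Lemma coef_coord_poly_sym k j w (t : 'I_m -> 'I_m) : injective t ->
  ((coord_poly k)`_j).@[config_coord (w \o t)] = ((coord_poly k)`_j).@[config_coord w].
Proof.
move=> t_inj; rewrite !coef_coord_polyE [in RHS](reindex_inj t_inj).
by [].
Qed.

End Configurations.

(** * Closedness of the orbit of the functional *)

Lemma monicXnD (R : nzRingType) (d : nat) (c : nat -> R) :
  'X^d + \poly_(j < d) c j \is monic.
Proof.
by rewrite monicE lead_coefDl ?lead_coefXn // size_polyXn ltnS size_poly.
Qed.

Lemma monic_polyE (R : nzRingType) (d : nat) (p : {poly R}) :
  p \is monic -> size p = d.+1 -> p = 'X^d + \poly_(j < d) p`_j.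
Proof.
move=> p_monic p_size; apply/polyP=> j; rewrite coefD coefXn coef_poly.
have [ltjd|lejd] := ltnP j d; first by rewrite ltn_eqF ?add0r.
rewrite addr0; have [->|neq] := eqVneq j d.
  by have := monicP p_monic; rewrite lead_coefE p_size.
by rewrite nth_default // p_size ltn_neqAle eq_sym neq.
Qed.

Section DualClosed.

Variables (F : closedFieldType) (V : vectType F) (form : {symmetric V}).
Hypothesis char0 : [pchar F] =i pred0.
Hypothesis nd : nondegenerate form.
Variables (n : nat) (b : n.-tuple V).
Hypothesis bB : basis_of {:V} b.
Hypothesis b_orthonormal : orthonormal form b.
Variables (m : nat) (u : {ffun 'I_m -> V}) (a : 'I_m -> F).
Hypothesis u_inj : injective u.
Hypothesis a_neq0 : forall i, a i != 0.
Hypothesis ndU : nondegenerate_on form <<codom u>>%VS.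

Local Notation N := #|{: 'I_m * 'I_n}|.
Local Notation dual_vars h := (fun i => coord (vbasis fullv) i h).

(* The factor [D] restricts the sum over all self-maps of the index set, coming
   from the tensor power of the functional, to the permutations preserving the
   Gram matrix of [u]; there the weights contribute the constant [\prod_i a i]. *)
Lemma symmetric_mpoly_of_dual : exists (D : {mpoly F[N]}) (kappa : F),
  kappa != 0 /\
  forall (e : nat) (q : {mpoly F[N]}) (g : 'End(V)),
    in_On form g -> (msize (D * q) <= e.+1)%N ->
    (forall (t : 'I_m -> 'I_m) w, injective t ->
       q.@[config_coord b (w \o t)] = q.@[config_coord b w]) ->
    (tensor_power_eval e (D * q)).@[dual_vars
       (dual_restr e (point_functional b a (diag_act g u)))] =
    kappa * q.@[config_coord b (diag_act g u)].
Proof.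
have [D [D_gram D0 Du]] := gram_separating_mpoly bB b_orthonormal u.
pose A := [set t : {ffun 'I_m -> 'I_m} | gram_fixed form u t].
(* Each map in [A] contributes the same term. As [A] contains the identity, its cardinality is
   nonzero in characteristic zero. *)
exists D, (#|A|%:R * (\prod_i a i) * D.@[config_coord b u]); split.
  rewrite !mulf_neq0 //; last by apply/prodf_neq0 => i _.
  rewrite (iffLR (pcharf0P F) char0) -lt0n; apply/card_gt0P.
  by exists [ffun i => i]; rewrite inE; apply/gram_fixedP=> i j; rewrite !ffunE.
move=> e q g gO q_deg q_sym; rewrite tensor_power_evalE //.
have gramg (t : 'I_m -> 'I_m) : D.@[config_coord b (diag_act g u \o t)] =
    D.@[config_coord b (u \o t)].
  by apply: D_gram => i j /=; rewrite !ffunE gO.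
rewrite (bigID (mem A)) /= [X in _ + X]big1 ?addr0 => [|t]; last first.
  by rewrite inE => tA; rewrite mevalM gramg D0 // mul0r mulr0.
rewrite -!mulrA mulr_natl -sumr_const; apply: eq_bigr => t; rewrite inE => tA.
have t_inj := gram_fixed_inj u_inj ndU tA.
rewrite mevalM gramg q_sym // [\prod_i a i](reindex_inj t_inj) !mulrA.
congr (_ * _ * _); apply: D_gram => i j /=.
exact: (gram_fixedP _ _ _ tA).
Qed.

Lemma nondegenerate_dual_closed : exists e0 : nat, forall e, (e0 <= e)%N ->
  zariski_closed (On_orbit form (@dual_act F V n b e)
    (dual_restr e (point_functional b a u))).
Proof.
have [D [kappa [kappa0 DP]]] := symmetric_mpoly_of_dual.
pose e0 := \max_(k < n) \max_(j < m) msize (D * (coord_poly F m k)`_j).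
exists e0 => e le_e; apply: zariski_closedI => h vanish.
(* The isometries parametrize the orbit; [ev] evaluates polynomials on the dual at its points, and
   [chi] at the point [h] of its closure. *)
pose X := {g : 'End(V) | in_On form g}.
pose conf (x : X) := diag_act (sval x) u.
pose P := {mpoly F[\dim {: bpoly_dual F n e}]}.
pose ev (x : X) : {rmorphism P -> F} :=
  meval (dual_vars (dual_restr e (point_functional b a (conf x)))).
pose chi : {rmorphism P -> F} := meval (dual_vars h).
have ev_chi f : (forall x, ev x f = 0) -> chi f = 0.
  move=> f0; apply: vanish => _ [g gO ->].
  by rewrite (dual_act_point_functional nd bB) //; apply: (f0 (exist _ g gO)).
pose z k x := if insub k : option 'I_N is Some l then config_coord b (conf x) l else 0.
have zE (l : 'I_N) x : z l x = config_coord b (conf x) l by rewrite /z valK.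
have integral k : (k < N)%N -> exists2 p : {poly P}, p \is monic &
    forall x, root (map_poly (ev x) p) (z k x).
  move=> ltk; pose l := Ordinal ltk; pose k2 := (enum_val l).2.
  pose c j := kappa^-1 *: tensor_power_eval e (D * (coord_poly F m k2)`_j).
  (* The leading coefficient stays 1; each lower coefficient of [coord_poly] is replaced by a
     polynomial on the dual that agrees with it along the orbit. *)
  exists ('X^m + \poly_(j < m) c j) => [|x]; first exact: monicXnD.
  rewrite (zE l); have -> : map_poly (ev x) ('X^m + \poly_(j < m) c j) =
      \prod_i ('X - (coord b k2 (conf x i))%:P).
    rewrite [RHS](@monic_polyE _ m) ?monic_prod_XsubC //; last first.
      by rewrite size_prod_XsubC /index_enum -enumT size_enum_ord.
    rewrite rmorphD /= map_polyXn; congr (_ + _); apply/polyP=> j.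
    rewrite coef_map !coef_poly; case: ifP => [ltj|_]; last exact: (rmorph0 (ev x)).
    rewrite /= mevalZ DP.
    - by rewrite mulKf // coef_coord_polyE.
    - exact: svalP x.
    - rewrite (leq_trans _ (leqW le_e)) //.
      apply: leq_trans (leq_bigmax (F := fun k : 'I_n =>
        \max_(j < m) msize (D * (coord_poly F m k)`_j)) k2).
      exact: (leq_bigmax (F := fun j : 'I_m =>
        msize (D * (coord_poly F m k2)`_j)) (Ordinal ltj)).
    - by move=> t w t_inj; apply: coef_coord_poly_sym.
  by rewrite /root horner_prod (bigD1 (enum_val l).1) //= !hornerE subrr mul0r.
have chiK : cancel (@mpolyC _ F : F -> P) chi by move=> c; apply: mevalC.
have [P' [j [ev' [chi' [Z [ev'E chi'E ev_chi' ZE]]]]]] :=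
  integral_extension chiK ev_chi integral.
(* A function of the configuration that equals a function of the functional along the orbit still
   equals it at the limit. *)
have transfer (q : {mpoly F[N]}) (p : P) :
    (forall x, q.@[config_coord b (conf x)] = ev x p) ->
    q.@[fun l : 'I_N => chi' (Z l)] = chi p.
  move=> qp; pose jC := j \o @mpolyC _ F.
  have chi'K : cancel jC chi' by move=> c; rewrite /= chi'E; apply: mevalC.
  have ev'K x : cancel jC (ev' x) by move=> c; rewrite /= ev'E; apply: mevalC.
  rewrite -(rmorph_mmap (fun l : 'I_N => Z l) q chi'K) -chi'E; apply/subr0_eq.
  rewrite -rmorphB; apply: ev_chi' => x; rewrite rmorphB /= ev'E -qp.
  rewrite (rmorph_mmap _ _ (ev'K x)); apply/eqP; rewrite subr_eq0; apply/eqP.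
  by apply: meval_eq => l; rewrite ZE // zE.
pose w : {ffun 'I_m -> V} :=
  [ffun i => \sum_(k < n) chi' (Z (enum_rank (i, k))) *: b`_k].
have transferw (q : {mpoly F[N]}) (p : P) :
    (forall x, q.@[config_coord b (conf x)] = ev x p) ->
    q.@[config_coord b w] = chi p.
  move=> /transfer <-; apply: meval_eq => l; rewrite /config_coord ffunE.
  rewrite coord_sum_free ?(basis_free bB) //.
  by rewrite -surjective_pairing enum_valK.
(* Gram entries and linear relations are constant along the orbit, so they transfer to [w], and
   Witt's theorem applies. *)
have [g gO wE] : On_orbit form (@diag_act F V m) u w.
  apply: (isometry_extension char0 nd ndU) => [i i'|c c0].
    rewrite -(gram_mpolyE bB b_orthonormal).
    rewrite (transferw _ (form (u i) (u i'))%:MP) ?[LHS]mevalC // => x.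
    by rewrite [RHS]mevalC (gram_mpolyE bB b_orthonormal) !ffunE (svalP x).
  rewrite (coord_basis bB (memvf (\sum_i _))) big1 // => k _.
  have relE (w' : 'I_m -> V) : (\sum_i c i *: config_var F i k).@[config_coord b w'] =
      coord b k (\sum_i c i *: w' i).
    rewrite raddf_sum linear_sum; apply: eq_bigr => i _ /=.
    by rewrite mevalZ config_varE linearZ.
  rewrite -relE (transferw _ 0) ?rmorph0 ?scale0r // => x.
  rewrite rmorph0 relE; under eq_bigr do rewrite ffunE -linearZ.
  by rewrite -linear_sum c0 !linear0.
exists g => //; rewrite (dual_act_point_functional nd bB) // -wE.
apply/lfunP=> p; rewrite dual_restrE /= -eval_mpolyE.
(* The value at [p] of the functional of a configuration, as a polynomial in the configuration; its
   transfer identifies [h p]. *)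
pose q := \sum_i a i *: (bpoly_val p \mPo [tuple config_var F i k | k < n]).
have qE w' : q.@[config_coord b w'] = \sum_i a i * mpoly_at b p (w' i).
  rewrite raddf_sum; apply: eq_bigr => i _ /=; rewrite mevalZ comp_mpoly_meval.
  congr (_ * _); apply: meval_eq => k; rewrite tnth_mktuple.
  exact: config_varE.
rewrite /point_functional -qE (transferw _ (eval_mpoly p)) // => x.
by rewrite qE /= eval_mpolyE dual_restrE.
Qed.

End DualClosed.

Theorem theorem6p1 (F : closedFieldType) (F0 : [pchar F] =i pred0)
    (V : vectType F) (form : {symmetric V}) (nd : nondegenerate form)
    (n : nat) (b : n.-tuple V) (bB : basis_of {:V} b)
    (b_orthonormal : orthonormal form b)
    (m : nat) (u : {ffun 'I_m -> V}) (u_inj : injective u)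
    (a : 'I_m -> F) (a_neq0 : forall i, a i != 0) :
  [<-> exists e0 : nat, forall e : nat, (e0 <= e)%N ->
         zariski_closed
           (On_orbit form (@dual_act F V n b e)
              (dual_restr e (point_functional b a u)));
       zariski_closed (On_orbit form (@diag_act F V m) u);
       nondegenerate_on form <<codom u>>%VS].
Proof.
tfae.
(* The first implication of the cycle passes through nondegeneracy of the span. *)
- move=> [e0 closed]; apply: (nondegenerate_closed F0 nd bB b_orthonormal).
  exact: (dual_closed_nondegenerate F0 nd bB u_inj a_neq0 closed).
- exact: closed_nondegenerate.
- exact: nondegenerate_dual_closed.
Qed.
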